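(* Let $G$ be a connected graph with at least $3$ vertices. Then $g(G)=tr(G)$ holds if and only if $G$ is a complete graph or a cycle.
   Context: All graphs are finite, simple and undirected. $d(u,v)$ denotes the usual shortest-path distance. The triameter of a connected graph $G=(V,E)$ on at least $3$ vertices is $tr(G)=\max\{d(u,v)+d(v,w)+d(u,w): u,v,w\in V\}$. The girth $g(G)$ is the length of a shortest cycle of $G$, if a cycle exists; for an acyclic $G$ the equality $g(G)=tr(G)$ is understood not to hold. *)

(* Defs.v *)
From mathcomp Require Import all_boot.
Set Implicit Arguments.
Unset Strict Implicit.
Unset Printing Implicit Defensive.

(* A finite simple graph is a symmetric irreflexive relation
   on a finType; these two hypotheses are made explicit in the theorem. *)

Section Graph.
Variables (T : finType) (e : rel T).

Definition connected_graph := forall u v : T, connect e u v.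

Definition has_path (u v : T) (k : nat) : bool :=
  [exists p : k.-tuple T,
     [&& path e u p, last u p == v & uniq (u :: p)]].

(* A path has fewer than #|T| edges, so no path is excluded by the range of k.
   The default #|T| is only taken when no path exists. *)
Definition gdist (u v : T) : nat :=
  \big[minn/#|T|]_(k < #|T| | has_path u v k) (k : nat).

Definition triameter : nat :=
  \max_(u : T) \max_(v : T) \max_(w : T) (gdist u v + gdist v w + gdist u w).

(* The bound 2 < k rules out the "cycles" [::] and [:: x; y] that ucycleb
   accepts. *)
Definition has_cycle (k : nat) : bool :=
  (2 < k) && [exists c : k.-tuple T, ucycleb e c].

(* None for acyclic graphs.  A cycle has at most #|T| vertices, so neither the
   range of k nor the default value #|T| affects the minimum. *)
Definition girth : option nat :=
  if [exists k : 'I_#|T|.+1, has_cycle k]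
  then Some (\big[minn/#|T|]_(k < #|T|.+1 | has_cycle k) (k : nat))
  else None.

Definition complete_graph := forall u v : T, u != v -> e u v.

(* Isomorphic to C_n on 'I_n; ordS is the cyclic successor. *)
Definition cycle_graph :=
  exists n : nat, 2 < n /\
  exists2 f : 'I_n -> T, bijective f &
    forall i j : 'I_n, e (f i) (f j) = (j == ordS i) || (i == ordS j).

End Graph.

(* Main.v *)
Require Import Defs.
From mathcomp Require Import all_boot.
From mathcomp Require Import zify.

(** Everything rests on one fact: two different simple paths with the same ends
    contain a cycle that is no longer than the two paths together
    ([cycle_of_two_paths]).  Hence in a graph of girth g a simple path of length
    l forces the distance between its ends to be at least min(l, g - l)
    ([gdist_nth_geq]): a shorter path would close a cycle shorter than g.

    Suppose the girth g equals the triameter. If g = 3, then twice any distance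
    is at most 3, so the graph is complete. If g > 3, take a cycle of length g
    and suppose that it misses a vertex. By connectedness it misses a neighbour
    x of one of its vertices; number them c_0, ..., c_(g-1) so that x is
    adjacent to c_0. With m = floor(g / 2), the two ways round the cycle are
    simple paths from x to c_(m-1) and to c_(m+1), of lengths m and g - m, so
    both these vertices are at distance at least m from x, and they are at
    distance at least 2 from each other since g > 3. The three vertices then
    have distance sum at least 2m + 2 > g, a contradiction
    ([min_cycle_spanning]). So the cycle is spanning, and it has no chord,
    because a chord would give a shorter cycle.

    Conversely, K_n with n > 2 has girth and triameter 3. In C_n every vertex
    has only two neighbours, so a cycle contains all neighbours of its vertices
    and is therefore spanning: the girth is n ([cycle_graph_cycle_size]). Three
    vertices cut the cycle into arcs whose lengths add up to n and bound the
    distances, so the triameter is at most n ([triameter_leq_hamiltonian]).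
    Three vertices that cut it into arcs of length at most n / 2 attain this
    bound, because such arcs are geodesics ([triameter_geq_girth]). *)

Set Implicit Arguments.
Unset Strict Implicit.

(** * Girth, distance and triameter through cycles and paths *)

(** [minn] has no neutral element, so the minimum is either attained or
    equal to the default d, and each use has to deal with the second case. *)
Lemma bigmin_spec (I : finType) (P : pred I) (F : I -> nat) (d : nat) :
  let m := \big[minn/d]_(i | P i) F i in
  (forall i, P i -> m <= F i) /\ (m = d \/ exists2 i, P i & m = F i).
Proof.
split.
  move=> i Pi; rewrite -big_filter.
  have: i \in [seq j <- index_enum I | P j] by rewrite mem_filter Pi mem_index_enum.
  elim: [seq _ <- _ | _] => //= j s IH; rewrite inE big_cons geq_min.
  by case/predU1P=> [->|/IH->]; rewrite ?leqnn ?orbT.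
apply: (big_ind (fun m => m = d \/ exists2 i, P i & m = F i)).
- by left.
- by move=> x y Hx Hy; rewrite /minn; case: ifP.
- by move=> i Pi; right; exists i.
Qed.

Section Graph.
Context {T : finType} (e : rel T).
Hypotheses (e_sym : symmetric e) (e_conn : connected_graph e).
Implicit Types (u v x y z : T) (p q s : seq T).

Lemma path_rev_sym x p : path e x p -> path e (last x p) (rev (belast x p)).
Proof. by rewrite rev_path; under eq_path => y z do rewrite e_sym. Qed.

Lemma uniq_leq_card s : uniq s -> size s <= #|T|.
Proof. by move/card_uniqP <-; exact: max_card. Qed.

Lemma has_cycleP k :
  reflect (2 < k /\ exists2 s : seq T, size s = k & ucycle e s) (has_cycle e k).
Proof.
apply: (iffP andP) => [[k2 /existsP[c cc]] | [k2 [s sk cs]]].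
  by split=> //; exists c; [exact: size_tuple | exact: cc].
by split=> //; apply/existsP; exists (Tuple (introT eqP sk)).
Qed.

Lemma has_cycle_leq_card k : has_cycle e k -> k <= #|T|.
Proof.
by case/has_cycleP=> _ [s <- /andP[_ /uniq_leq_card]].
Qed.

Lemma girthP g :
  girth e = Some g <-> has_cycle e g /\ (forall k, has_cycle e k -> g <= k).
Proof.
rewrite /girth; set m := \big[_/_]_(_ | _) _.
have [le_m eq_m] := bigmin_spec (fun k : 'I_#|T|.+1 => has_cycle e k)
  (@nat_of_ord _) #|T|.
rewrite -/m in le_m eq_m.
have min_m k : has_cycle e k -> m <= k.
  move=> ck; have lt_k : k < #|T|.+1 by exact: has_cycle_leq_card.
  exact: (le_m (Ordinal lt_k)).
case: ifP => [/existsP[k0 ck0]|noc]; last first.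
  split=> // -[/[dup] cg /has_cycle_leq_card lt_g _].
  by case/existsP: noc; exists (Ordinal (lt_g : g < #|T|.+1)).
have cm : has_cycle e m.
  case: eq_m => [eq_m|[i ci ->]] //.
  suff -> : m = k0 by [].
  by apply/eqP; rewrite eqn_leq min_m //= eq_m -ltnS.
split=> [[<-]|[cg min_g]] //.
by congr Some; apply/eqP; rewrite eqn_leq min_m // min_g.
Qed.

(** The path need not be simple: it can be shortened to a simple one, which is
    what the definition of the distance ranges over. *)
Lemma gdist_leq_size u p : path e u p -> gdist e u (last u p) <= size p.
Proof.
move=> pp; case/shortenP: (pp) => q pq uq /uniq_leq_size leq_qp.
rewrite (leq_trans _ (leq_qp _)) //; last by case/andP: uq.
have lt_q : size q < #|T| by exact: (@uniq_leq_card (u :: q)).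
have [le_d _] := bigmin_spec (fun k : 'I_#|T| => has_path e u (last u q) k)
  (@nat_of_ord _) #|T|.
apply: (le_d (Ordinal lt_q)); apply/existsP; exists (in_tuple q).
by rewrite pq eqxx.
Qed.

Lemma geodesic u v : exists p,
  [/\ path e u p, last u p = v, uniq (u :: p) & size p = gdist e u v].
Proof.
have [_ eq_d] := bigmin_spec (fun k : 'I_#|T| => has_path e u v k)
  (@nat_of_ord _) #|T|.
rewrite -/(gdist e u v) in eq_d.
(* The default value #|T| is excluded, as a simple path is shorter than that. *)
case: eq_d => [eq_d|[k /existsP[p /and3P[pp /eqP <- up]] ->]]; last first.
  by exists p; rewrite size_tuple.
case/connectP: (e_conn u v) => p0 pp0 def_v.
case/shortenP: pp0 def_v => p pp up _ def_v.
have := gdist_leq_size pp; rewrite -def_v eq_d => le_Tp.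
have : size (u :: p) <= #|T| by exact: uniq_leq_card.
by move=> /leq_trans/(_ le_Tp); rewrite ltnn.
Qed.

Lemma gdist_sym u v : gdist e u v = gdist e v u.
Proof.
wlog suff: u v / gdist e u v <= gdist e v u.
  by move=> H; apply/eqP; rewrite eqn_leq !H.
have [p [/path_rev_sym pp <- _ <-]] := geodesic v u.
have := gdist_leq_size pp; rewrite size_rev size_belast.
by case: p {pp} => //= x p; rewrite rev_cons last_rcons.
Qed.

Lemma triameter_geq u v w :
  gdist e u v + gdist e v w + gdist e u w <= triameter e.
Proof.
apply: leq_trans (leq_bigmax u); apply: leq_trans (leq_bigmax v).
exact: leq_bigmax w.
Qed.

(** * Two paths enclose a cycle *)

(** After a common initial segment is removed, the paths leave u by different
    edges.  The first vertex z of p that also lies on q then closes a cycle: go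
    from u to z along p and come back along q. *)
Lemma cycle_of_two_paths u p q :
  path e u p -> path e u q -> uniq (u :: p) -> uniq (u :: q) ->
  last u p = last u q -> p != q ->
  exists2 k, has_cycle e k & k <= size p + size q.
Proof.
elim: p u q => [|x p IH] u [|y q] //.
- by move=> _ _ _ /andP[uq _] /= def_u; rewrite def_u mem_last in uq.
- by move=> _ _ /andP[up _] _ /= def_u; rewrite -def_u mem_last in up.
move=> pp pq up uq lpq.
have [eq_xy | neq_xy _] := eqVneq x y.
  subst y; rewrite eqseq_cons eqxx => neq.
  case/andP: pp pq => _ pp /andP[_ pq]; case/andP: up => _ up; case/andP: uq => _ uq.
  by have [k ck lek] := IH _ _ pp pq up uq lpq neq; exists k => //=; lia.
have [z [p1 [p2 [def_p zq p1q]]]] : exists z p1 p2,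
    [/\ x :: p = p1 ++ z :: p2, z \in y :: q & ~~ has [in y :: q] p1].
  have /split_find[z p1 p2 zq p1q] : has [in y :: q] (x :: p).
    apply/hasP; exists (last x p); first exact: mem_last.
    by rewrite /= (lpq : last x p = last y q) mem_last.
  by exists z, p1, p2; rewrite cat_rcons.
have [q1 [q2 def_q]] : exists q1 q2, y :: q = q1 ++ z :: q2.
  by case/splitPr: zq => q1 q2; exists q1, q2.
rewrite def_p in pp up *; rewrite def_q in pq uq p1q *.
have {}pp : path e u (rcons p1 z).
  by move: pp; rewrite -cat_rcons cat_path => /andP[].
have {pq} /path_rev_sym : path e u (rcons q1 z).
  by move: pq; rewrite -cat_rcons cat_path => /andP[].
rewrite last_rcons belast_rcons rev_cons => pq.
exists (size (u :: p1 ++ z :: rev q1)); last by rewrite /= !size_cat /= size_rev; lia.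
apply/has_cycleP; split.
  rewrite /= size_cat /= size_rev.
  (* A cycle of length 2 would mean that z is the first vertex of both paths. *)
  case: p1 def_p {pp up p1q} => [|a p1]; last by rewrite /=; lia.
  case: q1 def_q {uq pq} => [|b q1] /=; last by lia.
  by case=> <- _ [eq_xy _]; rewrite eq_xy eqxx in neq_xy.
exists (u :: p1 ++ z :: rev q1) => //; apply/andP; split.
  by rewrite /= rcons_cat -cat_rcons cat_path pp last_rcons.
have : uniq ((u :: p1) ++ z :: rev q1); last by [].
rewrite cat_uniq; apply/and3P; split.
- by move: up; rewrite -cat_cons cat_uniq => /and3P[].
- have zu : z != u.
    by move: up; rewrite /= mem_cat inE eq_sym; case: eqP => //; rewrite orbT.
  apply/hasPn => t; rewrite inE mem_rev => /predU1P[->|tq].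
    rewrite !inE negb_or zu.
    move: up; rewrite -cat_cons cat_uniq /= => /and3P[_ /norP[]].
    by rewrite inE => /norP[].
  rewrite !inE negb_or; apply/andP; split.
    by apply/eqP=> def_t; move: uq; rewrite /= mem_cat -def_t tq.
  by apply/negP => /(hasPn p1q); rewrite /= mem_cat tq.
- move: uq; rewrite /= cat_uniq /= rev_uniq mem_rev.
  by case/andP=> _ /and4P[-> /norP[-> _] _ _].
Qed.

Lemma subpath x0 x p i j : path e x p -> i <= j <= size p ->
  exists q, [/\ path e (nth x0 (x :: p) i) q,
    last (nth x0 (x :: p) i) q = nth x0 (x :: p) j, size q = j - i
    & uniq (x :: p) -> uniq (nth x0 (x :: p) i :: q)].
Proof.
elim: i x p j => [|i IH] x p j pp /andP[lij ljp]; last first.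
  case: j p pp lij ljp => [|j] [|y p] //= /andP[_ pp] lij ljp.
  have [q [pq lq sq uq]] := IH _ _ j pp (introT andP (conj lij ljp)).
  by exists q; split=> // /andP[_ /uq].
exists (take j p); split=> /=.
- exact: take_path.
- case: j {lij} ljp => [|j] ljp; first by rewrite take0.
  by rewrite (last_nth x0) size_takel // -[LHS]/(nth x0 (take j.+1 p) j) nth_take.
- by rewrite size_takel // subn0.
- exact: (take_uniq (s := x :: p) j.+1).
Qed.

Lemma gdist_nth_leq x0 x p i j : path e x p -> i <= j <= size p ->
  gdist e (nth x0 (x :: p) i) (nth x0 (x :: p) j) <= j - i.
Proof.
by move=> pp lij; have [q [pq <- <- _]] := subpath x0 pp lij; exact: gdist_leq_size.
Qed.

(** The positions i and j are l = j - i apart on p.  A path of length less than d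
    between them would differ from this segment, as d is at most l, and the two
    would enclose a cycle of length less than d + l, hence less than g. *)
Lemma gdist_nth_geq g x0 x p i j d :
  (forall k, has_cycle e k -> g <= k) ->
  path e x p -> uniq (x :: p) -> i <= j <= size p ->
  d <= j - i -> d + (j - i) <= g ->
  d <= gdist e (nth x0 (x :: p) i) (nth x0 (x :: p) j).
Proof.
move=> min_g pp up lij; have [q [pq <- <- /(_ up) uq]] := subpath x0 pp lij.
move=> led leg; rewrite leqNgt; apply/negP.
have [r [pr lr ur <-]] :=
  geodesic (nth x0 (x :: p) i) (last (nth x0 (x :: p) i) q).
move=> ltr; have neq_rq : r != q.
  by apply: contraTneq ltr => ->; rewrite -leqNgt.
have [k /min_g le_gk le_k] := cycle_of_two_paths pr pq ur uq lr neq_rq.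
lia.
Qed.

Lemma gdist_adj u v : e u v -> gdist e u v <= 1.
Proof. by move=> uv; apply: (@gdist_leq_size u [:: v]); rewrite /= uv. Qed.

Lemma adj_gdist u v : u != v -> gdist e u v <= 1 -> e u v.
Proof.
have [p [pp <- _ <-]] := geodesic u v.
by case: p pp => [|y [|z p]] //=; rewrite ?eqxx ?andbT.
Qed.

Lemma gdist_gt0 u v : u != v -> 0 < gdist e u v.
Proof. by have [[|x p] [_ /= <- _ <-]] := geodesic u v; rewrite ?eqxx. Qed.

(** * Walking round a cycle *)

(** Cyclic adjacency by position, with the wrap-around written as it is in the
    cyclic successor of ordinals. *)
Lemma cycle_nthP x0 s :
  reflect (forall i, i < size s -> e (nth x0 s i) (nth x0 s (i.+1 %% size s)))
          (cycle e s).
Proof.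
case: s => [|x p]; first by left.
have nthE i : i < (size p).+1 ->
    (nth x0 (x :: rcons p x) i = nth x0 (x :: p) i)
    * (nth x0 (rcons p x) i = nth x0 (x :: p) (i.+1 %% (size p).+1)).
  move=> lti; rewrite -rcons_cons !nth_rcons /= lti; split=> //.
  move: lti; rewrite ltnS leq_eqVlt => /predU1P[->|lti].
    by rewrite ltnn eqxx modnn.
  by rewrite lti modn_small.
apply: (iffP (pathP x0)); rewrite size_rcons => H i lti; have := H i lti;
  by rewrite !nthE.
Qed.

Lemma connected_ind (P : pred T) x : P x ->
  (forall u v, e u v -> P u -> P v) -> forall y, P y.
Proof.
move=> Px Pe y; have sub : closed e P.
  by move=> u v; apply: (intro_closed (sym_connect_sym e_sym)) u v => u v; exact: Pe.
by rewrite -[P y]/(y \in P) -(closed_connect sub (e_conn x y)).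
Qed.

(** A cycle can be cut open at any of its vertices u, giving a closed walk from u
    to u. *)
Lemma ucycle_from s u : ucycle e s -> u \in s ->
  exists t : seq T, [/\ path e u (rcons t u), uniq (u :: t),
    size s = (size t).+1 & s =i u :: t].
Proof.
move=> cs /rot_to[r t rot_s]; exists t.
move: cs; rewrite /ucycle -(rot_cycle r) -(rot_uniq r) rot_s => /andP[ct ut].
by split=> // [|x]; [rewrite -(size_rot r) rot_s | rewrite -(mem_rot r) rot_s].
Qed.

(** * Complete graphs and cycles have equal girth and triameter *)

Lemma complete_girth_triameter :
  3 <= #|T| -> complete_graph e -> girth e = Some (triameter e).
Proof.
move=> /card_gt2P[x [y [z [_ [xy yz zx]]]]] comp.
suff -> : triameter e = 3.
  apply/girthP; split=> [|k /has_cycleP[]//].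
  apply/has_cycleP; split=> //; exists [:: x; y; z] => //.
  by rewrite /ucycle /= !comp //= !inE negb_or xy yz eq_sym zx.
apply/eqP; rewrite eqn_leq; apply/andP; split; last first.
  apply: leq_trans (triameter_geq x y z).
  have := gdist_gt0 xy; have := gdist_gt0 yz.
  by rewrite eq_sym in zx; have := gdist_gt0 zx; lia.
have le1 u v : gdist e u v <= 1.
  have [->|/comp/gdist_adj //] := eqVneq u v.
  by rewrite (leq_trans (@gdist_leq_size v [::] _)).
apply/bigmax_leqP=> u _; apply/bigmax_leqP=> v _; apply/bigmax_leqP=> w _.
by have := le1 u v; have := le1 v w; have := le1 u w; lia.
Qed.

Lemma cycle_graph_has_hamiltonian :
  cycle_graph e -> exists2 s : seq T, size s = #|T| & ucycle e s.
Proof.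
case=> n [n_gt2 [f bij_f adj_f]].
have size_s : size [seq f i | i <- enum 'I_n] = n by rewrite size_map size_enum_ord.
exists [seq f i | i <- enum 'I_n].
  by rewrite size_s -(bij_eq_card bij_f) card_ord.
apply/andP; split; last by rewrite map_inj_uniq ?enum_uniq //; exact: bij_inj.
case: n n_gt2 f bij_f adj_f size_s => // n _ f _ adj_f size_s.
have nth_s (i : 'I_n.+1) : nth (f ord0) [seq f i | i <- enum 'I_n.+1] i = f i.
  by rewrite (nth_map ord0) ?nth_ord_enum // size_enum_ord.
apply/(cycle_nthP (f ord0)); rewrite size_s => i lti.
rewrite (nth_s (Ordinal lti)) (nth_s (ordS (Ordinal lti))) adj_f.
by rewrite eqxx.
Qed.

(** The two neighbours of v on the cycle s are distinct, and v has only two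
    neighbours in the whole graph.  So s is closed under adjacency, and by
    connectedness it contains every vertex. *)
Lemma cycle_graph_cycle_size k : cycle_graph e -> has_cycle e k -> k = #|T|.
Proof.
case=> n [_ [f bij_f adj_f]] /has_cycleP[k_gt2 [s size_s /andP[cs us]]].
suff s_all x : x \in s.
  rewrite -size_s -(card_uniqP us); apply/eq_card => x.
  by rewrite s_all.
have [x0 x0s] : exists x0, x0 \in s.
  by case: s size_s {cs us} k_gt2 => [<-|x0 s] //; exists x0; exact: mem_head.
apply: (connected_ind (P := [in s]) x0s) => v w vw vs.
have [f' fK f'K] := bij_f.
have [t [pt ut size_t st]] := ucycle_from (introT andP (conj cs us)) vs.
move: pt ut; rewrite /= st; rewrite size_s in size_t.
case: t size_t {st} => [|a t] /= size_t; first by lia.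
case/lastP: t size_t => [|t b] /= size_t; first by lia.
rewrite rcons_path /= last_rcons => /and3P[va _ bv] /and3P[_ a_t _].
have neq_ab : a != b by apply: contraNneq a_t => ->; rewrite mem_rcons mem_head.
have adjE z : e v z -> z = f (ordS (f' v)) \/ z = f (ord_pred (f' v)).
  rewrite -{1}(f'K v) -{1}(f'K z) adj_f => /orP[/eqP|/eqP] def.
    by left; rewrite -def f'K.
  by right; rewrite def ordSK f'K.
rewrite e_sym in bv.
rewrite !inE mem_rcons inE.
move: neq_ab; case: (adjE _ va) (adjE _ bv) (adjE _ vw) => -> [] -> [] ->;
  by rewrite ?eqxx ?orbT.
Qed.

(** Cut the cycle open at u and order v and w by position: the three arcs from u
    to v, from v to w and from w back to u have total length [size s]. *)
Lemma triameter_leq_hamiltonian s :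
  size s = #|T| -> ucycle e s -> triameter e <= size s.
Proof.
move=> size_s /andP[cs us].
have s_all x : x \in s.
  have eq_card_s : #|s| = #|T| by rewrite -size_s; exact/card_uniqP.
  by rewrite (subset_cardP eq_card_s (subset_predT _)).
apply/bigmax_leqP=> u _; apply/bigmax_leqP=> v _; apply/bigmax_leqP=> w _.
have [t [pt _ -> st]] := ucycle_from (introT andP (conj cs us)) (s_all u).
have {st}s_all x : x \in u :: t by rewrite -st.
have nthE x : nth u (u :: rcons t u) (index x (u :: t)) = x.
  by rewrite -rcons_cons nth_rcons index_mem s_all nth_index.
have lt_index x : index x (u :: t) <= size t by rewrite -ltnS index_mem s_all.
wlog le_vw : v w / index v (u :: t) <= index w (u :: t).
  move=> H; have [/H //|/ltnW/H] := leqP (index v (u :: t)) (index w (u :: t)).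
  by rewrite (gdist_sym w v); lia.
have nth_last : nth u (u :: rcons t u) (size t).+1 = u.
  by rewrite /= nth_rcons ltnn eqxx.
have duv := @gdist_nth_leq u u (rcons t u) 0 (index v (u :: t)) pt.
have dvw := @gdist_nth_leq u u (rcons t u) (index v (u :: t)) (index w (u :: t)) pt.
have dwu := @gdist_nth_leq u u (rcons t u) (index w (u :: t)) (size t).+1 pt.
move: duv dvw dwu (lt_index v) (lt_index w).
rewrite !nthE nth_last [nth _ _ 0]/= size_rcons (gdist_sym w u).
move: (index v _) (index w _) le_vw => i j le_ij duv dvw dwu lei lej.
lia.
Qed.

(** On a shortest cycle, the vertices at positions 0, floor(g / 2) and g - 1 cut
    it into arcs of length at most g / 2, which are geodesics; these lengths add
    up to g. *)
Lemma triameter_geq_girth g : girth e = Some g -> g <= triameter e.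
Proof.
case/girthP=> /has_cycleP[g_gt2 [[|x p] size_s /andP[cs us]] min_g].
  by rewrite -size_s in g_gt2.
have px : path e x p by move: cs; rewrite /= rcons_path => /andP[].
rewrite /= in size_s.
have d1 := @gdist_nth_geq g x x p 0 g./2 g./2 min_g px us.
have d2 := @gdist_nth_geq g x x p g./2 g.-1 (g.-1 - g./2) min_g px us.
(* The third arc is the edge that closes the cycle, so it is enough that its
   ends differ. *)
have d3 : 0 < gdist e (nth x (x :: p) 0) (nth x (x :: p) g.-1).
  by apply: gdist_gt0; rewrite nth_uniq //=; lia.
apply: leq_trans (triameter_geq (nth x (x :: p) 0) (nth x (x :: p) g./2)
  (nth x (x :: p) g.-1)).
have := odd_double_half g.
lia.
Qed.

(** * Equal girth and triameter force a complete graph or a cycle *)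

(** If a vertex x off the cycle is adjacent to a vertex y on it, let c_0 = y and
    m = floor(g / 2).  The vertices c_(m-1) and c_(m+1) are at distance at least
    m from x, by the two ways round the cycle, and at distance at least 2 from
    each other; these add up to more than g. *)
Lemma min_cycle_spanning g s : 3 < g -> (forall k, has_cycle e k -> g <= k) ->
  triameter e <= g -> size s = g -> ucycle e s -> forall x, x \in s.
Proof.
move=> g_gt3 min_g tr_g; case: s => [|c0 s] size_s cs.
  by rewrite -size_s in g_gt3.
apply: (connected_ind (P := [in c0 :: s]) (mem_head c0 s)) => y x yx ys.
have [t [pt ut size_t st]] := ucycle_from cs ys.
rewrite size_s in size_t; apply: contraTT tr_g; rewrite /= st => xt.
rewrite -ltnNge.
set m := g./2.
(* In the sequence x, c_0, c_1, ... the vertex c_k has position k + 1; reading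
   the cycle backwards puts c_(m+1) at position g - m. *)
have path_t : path e x (y :: t).
  by rewrite /= e_sym yx; move: pt; rewrite rcons_path => /andP[].
have path_rev : path e x (y :: rev t).
  rewrite /= e_sym yx; have := path_rev_sym pt.
  by rewrite last_rcons belast_rcons rev_cons rcons_path => /andP[].
have uniq_t : uniq (x :: y :: t) by rewrite cons_uniq xt.
have uniq_rev : uniq (x :: y :: rev t).
  by rewrite (perm_uniq (s2 := x :: y :: t)) // !perm_cons perm_rev.
have def_g := odd_double_half g; rewrite -/m in def_g.
have d1 := @gdist_nth_geq g x x (y :: t) 0 m m min_g path_t uniq_t.
have d2 := @gdist_nth_geq g x x (y :: rev t) 0 (g - m) m min_g path_rev uniq_rev.
have d3 := @gdist_nth_geq g x x (y :: t) m m.+2 2 min_g path_t uniq_t.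
have eqm : nth x (x :: y :: rev t) (g - m) = nth x (x :: y :: t) m.+2.
  have -> : g - m = (g - m).-2.+2 by lia.
  rewrite /= nth_rev; last by lia.
  by congr nth; lia.
apply: leq_trans (triameter_geq x (nth x (x :: y :: t) m)
  (nth x (x :: y :: t) m.+2)).
rewrite eqm /= size_rev in d1 d2 d3 *.
lia.
Qed.

(** Otherwise the arc from i to j has length between 2 and g - 2, so its ends are
    at distance at least 2. *)
Lemma min_cycle_chordless g x0 s i j : (forall k, has_cycle e k -> g <= k) ->
  size s = g -> ucycle e s -> i < j < g -> e (nth x0 s i) (nth x0 s j) ->
  j = i.+1 \/ i = 0 /\ j.+1 = g.
Proof.
move=> min_g size_s /andP[cs us] lij /gdist_adj; case: s size_s cs us => [|x p].
  by move=> /= size_s; rewrite -size_s andbF in lij.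
rewrite /= rcons_path => size_s /andP[px _] us.
have := @gdist_nth_geq g x0 x p i j 2 min_g px us.
lia.
Qed.

Lemma girth_triameter_cycle_graph (e_irr : irreflexive e) g :
  3 < g -> girth e = Some g -> triameter e <= g -> cycle_graph e.
Proof.
move=> g_gt3 /girthP[/has_cycleP[g_gt2 [s size_s cs]] min_g] tr_g.
have s_all := min_cycle_spanning g_gt3 min_g tr_g size_s cs.
have x0 : T by case: s size_s g_gt2 {cs s_all} => [<-|].
have [/(cycle_nthP x0) cycs us] := andP cs.
exists g; split=> //; exists (fun i : 'I_g => nth x0 s i).
  apply: inj_card_bij => [i j /eqP|].
    by rewrite nth_uniq ?size_s // => /eqP/val_inj.
  by rewrite card_ord -size_s -(card_uniqP us); apply/subset_leq_card/subsetP.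
have adj_ordS (i : 'I_g) : e (nth x0 s i) (nth x0 s (ordS i)).
  by have := cycs i; rewrite size_s ltn_ord => /(_ isT).
have adjP (i j : 'I_g) : i < j -> e (nth x0 s i) (nth x0 s j) ->
    (j == ordS i) || (i == ordS j).
  move=> ltij ij.
  have ltj := ltn_ord j.
  have [|eq_j|[i0 jg]] := min_cycle_chordless (i := i) (j := j) min_g size_s cs _ ij.
  - by rewrite ltij ltn_ord.
  - by rewrite -val_eqE /= -eq_j modn_small ?eqxx.
  - by rewrite -!val_eqE /= jg modnn i0 eqxx orbT.
move=> i j; apply/idP/orP => [ij|[/eqP->|/eqP->]]; last 1 first.
- by rewrite e_sym.
- apply/orP; case: (ltngtP i j) => [ltij|ltji|/val_inj eqij].
  + exact: adjP.
  + by rewrite orbC; apply: adjP; rewrite // e_sym.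
  + by rewrite eqij e_irr in ij.
- by [].
Qed.

End Graph.

Theorem theorem3p7 (T : finType) (e : rel T)
    (e_sym : symmetric e) (e_irr : irreflexive e)
    (e_conn : connected_graph e) (T_ge3 : 3 <= #|T|) :
  girth e = Some (triameter e) <-> complete_graph e \/ cycle_graph e.
Proof.
split=> [girth_tr|[comp|cyc]].
- have [tr_le3|tr_gt3] := leqP (triameter e) 3; last first.
    by right; exact: girth_triameter_cycle_graph girth_tr _.
  (* The triple u, v, u shows that twice the distance is at most 3. *)
  left=> u v uv; apply: adj_gdist => //.
  have := triameter_geq e u v u; rewrite (gdist_sym e_sym e_conn v u); lia.
- exact: complete_girth_triameter.
- have [s size_s cs] := cycle_graph_has_hamiltonian cyc.
  have girth_s : girth e = Some #|T|.
    apply/girthP; split=> [|k ck].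
      by apply/has_cycleP; split=> //; exists s.
    by rewrite (cycle_graph_cycle_size e_sym e_conn cyc ck).
  rewrite girth_s; congr Some; apply/eqP; rewrite eqn_leq.
  rewrite (triameter_geq_girth e_sym e_conn girth_s) -size_s.
  exact: triameter_leq_hamiltonian.
Qed.
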